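(* Let $N\ge1$. The character $\chi=\sum_{i\in\{0,1\}^N}w_{i,i}$ of the magic representation $w$ of $\bar{O}_N$ is given by $\chi=\sum_{r=0}^N\chi_r$, where $$\chi_r=\sum_{A\subset\{1,\ldots,N\},\,|A|=r}\ \sum_{\sigma\in S_N^A}\ \prod_{a\in A}u_{a\sigma(a)}$$ with the product over $a\in A$ being ordered (in increasing order of $a$), and where $S_N^A=\{\sigma\in S_N\mid\sigma_{|A^c}=id\}$.
   Context: $\bar O_N$ is the compact quantum group whose algebra $C(\bar O_N)$ is the universal $C^*$-algebra generated by self-adjoint elements $u_{ij}$ ($1\le i,j\le N$) such that $u=(u_{ij})$ satisfies $u^t=u^{-1}$, and such that distinct entries $u_{ij},u_{kl}$ anticommute if they lie on the same row or the same column of $u$ and commute otherwise; its comultiplication is $\Delta(u_{ij})=\sum_k u_{ik}\otimes u_{kj}$. Let $g_1,\ldots,g_N$ be the standard generators of $\mathbb Z_2^N$. There is a coaction $\Phi:C^*(\mathbb Z_2^N)\to C(\bar O_N)\otimes C^*(\mathbb Z_2^N)$, $\Phi(g_i)=\sum_j u_{ij}\otimes g_j$ (the quantum isometric action of $\bar O_N$ on the $N$-hypercube). One identifies $C^*(\mathbb Z_2^N)$ with $C(\mathbb Z_2^N)$ via the Fourier isomorphism $\beta(g_1^{i_1}\cdots g_N^{i_N})=\sum_{j\in\{0,1\}^N}(-1)^{\langle i,j\rangle}\delta_{g_1^{j_1}\cdots g_N^{j_N}}$, where $\langle i,j\rangle=\sum_k i_kj_k$. The magic representation $w=(w_{i,k})_{i,k\in\{0,1\}^N}$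 of $\bar O_N$, giving $\bar O_N\subset S_{2^N}^+$, is the matrix of the resulting coaction $\Psi=(id\otimes\beta)\Phi\beta^{-1}$ on $C(\mathbb Z_2^N)$, that is, $\Psi(\delta_{g_1^{i_1}\cdots g_N^{i_N}})=\sum_{k} w_{i,k}\otimes\delta_{g_1^{k_1}\cdots g_N^{k_N}}$. *)

(* Defs.v *)
From HB Require Import structures.
From mathcomp Require Import all_boot all_order all_algebra all_fingroup.
From mathcomp Require Import complex.
From mathcomp Require Import reals.

Set Implicit Arguments.
Unset Strict Implicit.
Unset Printing Implicit Defensive.

Import Order.TTheory GRing.Theory Num.Theory.

Local Open Scope ring_scope.
Local Open Scope complex_scope.

(* Unital C*-algebras.  The norm is kept separate from the library's normed
   modules: Hierarchy-Builder refuses a structure that joins a normed module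
   with a ring outside of the number structures. *)
HB.mixin Record isCStarAlgebra (R : realType) A of GRing.Algebra R[i] A := {
  star : A -> A;
  starD : forall x y : A, star (x + y) = star x + star y;
  starZ : forall (c : R[i]) (x : A), star (c *: x) = Num.conj c *: star x;
  starM : forall x y : A, star (x * y) = star y * star x;
  starK : forall x : A, star (star x) = x;
  cnorm : A -> R;
  cnorm_eq0 : forall x : A, cnorm x = 0 -> x = 0;
  cnormD : forall x y : A, cnorm (x + y) <= cnorm x + cnorm y;
  cnormZ : forall (c : R[i]) (x : A),
    (cnorm (c *: x))%:C = `|c| * (cnorm x)%:C;
  cnormM : forall x y : A, cnorm (x * y) <= cnorm x * cnorm y;
  cnorm_star : forall x : A, cnorm (star x * x) = cnorm x ^+ 2;
  cnorm_complete : forall x : nat -> A,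
    (forall e : R, 0 < e -> exists n, forall p q,
       (n <= p)%N -> (n <= q)%N -> cnorm (x p - x q) < e) ->
    exists l : A, forall e : R, 0 < e -> exists n, forall p,
      (n <= p)%N -> cnorm (x p - l) < e
}.

#[short(type="cstarAlgType")]
HB.structure Definition CStarAlgebra (R : realType) :=
  {A of GRing.Algebra R[i] A & isCStarAlgebra R A}.

Section OnBar.
Variable R : realType.

Definition onbar_relations (N : nat) (A : cstarAlgType R) (u : 'M[A]_N) : Prop :=
  [/\ forall i j, star (u i j) = u i j,
      u *m u^T = 1%:M /\ u^T *m u = 1%:M,
      forall i j k l, (i, j) != (k, l) -> (i == k) || (j == l) ->
        u i j * u k l = - (u k l * u i j)
    & forall i j k l, i != k -> j != l -> u i j * u k l = u k l * u i j].

(* A is C(\bar O_N), with u its matrix of standard generators.  The uniqueness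
   part says that the u i j generate A. *)
Definition is_onbar (N : nat) (A : cstarAlgType R) (u : 'M[A]_N) : Prop :=
  onbar_relations u /\
  forall (B : cstarAlgType R) (v : 'M[B]_N), onbar_relations v ->
    (exists f : {lrmorphism A -> B},
       (forall x, f (star x) = star (f x)) /\ (forall i j, f (u i j) = v i j)) /\
    (forall f g : {lrmorphism A -> B},
       (forall x, f (star x) = star (f x)) -> (forall i j, f (u i j) = v i j) ->
       (forall x, g (star x) = star (g x)) -> (forall i j, g (u i j) = v i j) ->
       f =1 g).

End OnBar.

(* A \otimes C^*(G) for a finite abelian group G, written additively: the
   A-valued functions on G with the convolution product.  C^*(G) itself is the
   case where A is the field of complex numbers R[i]. *)
Definition galg (G : finZmodType) (A : Type) := {ffun G -> A}.

HB.instance Definition _ (G : finZmodType) (A : nzRingType) :=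
  GRing.Zmodule.on (galg G A).

Section GroupAlgebraRing.
Variables (G : finZmodType) (A : nzRingType).
Implicit Types (f h k : galg G A) (a : A) (g x : G).

(* a \otimes g *)
Definition gtens a g : galg G A := [ffun x => if x == g then a else 0].

Definition galg_mul f h : galg G A := [ffun g => \sum_x f x * h (g - x)].

Definition galg_one : galg G A := gtens 1 0.

Lemma galg_mulA : associative galg_mul.
Proof.
move=> f h k; apply/ffunP => g; rewrite !ffunE.
under eq_bigr do rewrite ffunE mulr_sumr.
under [RHS]eq_bigr do rewrite ffunE mulr_suml.
rewrite exchange_big [RHS]exchange_big /= exchange_big /=.
apply: eq_bigr => x _; rewrite [RHS](reindex_inj (addrI x)) /=.
by apply: eq_bigr => y _; rewrite mulrA opprD addrA [x + y]addrC addrK.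
Qed.

Lemma galg_mul1 : left_id galg_one galg_mul.
Proof.
move=> f; apply/ffunP => g; rewrite !ffunE (bigD1 0) //= ffunE eqxx mul1r subr0.
by rewrite big1 ?addr0 // => x /negPf x0; rewrite ffunE x0 mul0r.
Qed.

Lemma galg_mulr1 : right_id galg_one galg_mul.
Proof.
move=> f; apply/ffunP => g; rewrite !ffunE (bigD1 g) //= ffunE subrr eqxx mulr1.
rewrite big1 ?addr0 // => x xg; rewrite ffunE subr_eq0 eq_sym (negPf xg).
by rewrite mulr0.
Qed.

Lemma galg_mulDl : left_distributive galg_mul +%R.
Proof.
move=> f h k; apply/ffunP => g; rewrite !ffunE -big_split /=.
by apply: eq_bigr => x _; rewrite ffunE mulrDl.
Qed.

Lemma galg_mulDr : right_distributive galg_mul +%R.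
Proof.
move=> f h k; apply/ffunP => g; rewrite !ffunE -big_split /=.
by apply: eq_bigr => x _; rewrite ffunE mulrDr.
Qed.

Lemma galg_one_neq0 : galg_one != 0.
Proof.
by apply/eqP => /ffunP/(_ 0); rewrite !ffunE eqxx; apply/eqP/oner_neq0.
Qed.

HB.instance Definition _ := GRing.Zmodule_isNzRing.Build (galg G A)
  galg_mulA galg_mul1 galg_mulr1 galg_mulDl galg_mulDr galg_one_neq0.

End GroupAlgebraRing.

HB.instance Definition _ (K : nzRingType) (G : finZmodType) (A : lalgType K) :=
  GRing.Lmodule.copy (galg G A) {ffun G -> A}.

Section GroupAlgebraAlg.
Variables (K : nzRingType) (G : finZmodType) (A : lalgType K).

Lemma galg_scalerAl (c : K) (f h : galg G A) : c *: (f * h) = (c *: f) * h.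
Proof.
apply/ffunP => g; rewrite !ffunE scaler_sumr.
by apply: eq_bigr => x _; rewrite ffunE scalerAl.
Qed.

HB.instance Definition _ :=
  GRing.Lmodule_isLalgebra.Build K (galg G A) galg_scalerAl.

End GroupAlgebraAlg.

(* The involution (a \otimes g)^* = a^* \otimes g^{-1}, s being that of A. *)
Definition galg_star (G : finZmodType) (A : nzRingType) (s : A -> A)
  (f : galg G A) : galg G A := [ffun g => s (f (- g))].

(* Z_2^N, written additively; it is also used as the index set {0,1}^N, since
   the element g_1^{i_1} ... g_N^{i_N} is the vector i itself. *)
Notation cube N := 'rV['Z_2]_N.

Definition cube_gen N (k : 'I_N) : cube N := delta_mx 0 k.

Definition cube_dot N (i j : cube N) : nat :=
  (\sum_(k < N) (i ord0 k : nat) * (j ord0 k : nat))%N.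

Lemma cube_dotC N (i j : cube N) : cube_dot i j = cube_dot j i.
Proof. by apply: eq_bigr => k _; rewrite mulnC. Qed.

Section Fourier.
Variables (K : numFieldType) (N : nat) (A : lalgType K).

(* id \otimes beta, where A \otimes C(Z_2^N) is the algebra of A-valued
   functions on Z_2^N. *)
Definition fourier (f : galg (cube N) A) : {ffun cube N -> A} :=
  [ffun j => \sum_i (-1) ^+ cube_dot i j *: f i].

Definition fourier_inv (f : {ffun cube N -> A}) : galg (cube N) A :=
  [ffun i => (2 ^+ N)^-1 *: \sum_j (-1) ^+ cube_dot i j *: f j].

Lemma signD_Z2 (a b c : 'Z_2) :
  (-1) ^+ (a * c)%N * (-1) ^+ (b * c)%N = (-1) ^+ ((a + b)%R * c)%N :> K.
Proof.
by case: a b c => [[|[|//]] ?] [[|[|//]] ?] [[|[|//]] ?] /=;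
   rewrite ?muln0 ?expr0 ?expr1 ?mulr1 ?mul1r ?mulrNN ?mulr1.
Qed.

Lemma cube_dotD (i j k : cube N) :
  (-1) ^+ cube_dot i k * (-1) ^+ cube_dot j k = (-1) ^+ cube_dot (i + j) k :> K.
Proof.
rewrite /cube_dot !expr_sum -big_split /=.
by apply: eq_bigr => l _; rewrite mxE signD_Z2.
Qed.

Lemma cube_addii (i : cube N) : i + i = 0.
Proof.
by apply/rowP => k; rewrite !mxE; case: (i 0%R k) => [[|[|//]] ?]; apply/val_inj.
Qed.

Lemma cube_add_eq0 (i j : cube N) : (i + j == 0) = (i == j).
Proof.
by rewrite -[X in i + X]opprK subr_eq0 -[in LHS](addr0 (- j)) -(cube_addii j)
           addKr.
Qed.

Lemma cube_orth (i : cube N) :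
  \sum_j (-1) ^+ cube_dot i j = (if i == 0 then 2 ^+ N else 0) :> K.
Proof.
case: eqP => [->|/eqP /rV0Pn [k ik]].
  under eq_bigr => j _.
    rewrite /cube_dot big1 ?expr0; last by move=> l _; rewrite mxE.
    over.
  by rewrite sumr_const card_mx card_ord mul1n natrX.
have ik1 : i 0 k = 1 by case: (i 0 k) ik => [[|[|//]] ?] // _; apply/val_inj.
set S := LHS; have /eqP : S = - S.
  rewrite {1}/S (reindex_inj (addrI (cube_gen k))) /= -[- S]mulN1r mulr_sumr.
  apply: eq_bigr => j _; rewrite cube_dotC -cube_dotD; congr (_ * _).
    rewrite /cube_dot (bigD1 k) //= mxE !eqxx ik1 big1 ?addn0 ?expr1 // => l lk.
    by rewrite mxE (negPf lk) andbF.
  by rewrite cube_dotC.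
by rewrite -subr_eq0 opprK -mulr2n mulrn_eq0 /= => /eqP.
Qed.

Lemma cube_inversion (f : cube N -> A) (i : cube N) :
  \sum_j (-1) ^+ cube_dot i j *: (\sum_l (-1) ^+ cube_dot l j *: f l) =
  2 ^+ N *: f i.
Proof.
under eq_bigr do rewrite scaler_sumr.
rewrite exchange_big (bigD1 i) //= [X in _ + X]big1 ?addr0 => [|l li].
  under eq_bigr do rewrite scalerA cube_dotD.
  by rewrite -scaler_suml cube_orth cube_addii eqxx.
under eq_bigr do rewrite scalerA cube_dotD.
by rewrite -scaler_suml cube_orth cube_add_eq0 eq_sym (negPf li) scale0r.
Qed.

Lemma fourierK : cancel fourier fourier_inv.
Proof.
move=> f; apply/ffunP => i; rewrite ffunE.
under eq_bigr do rewrite ffunE.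
by rewrite cube_inversion scalerA mulVf ?scale1r // expf_neq0 // pnatr_eq0.
Qed.

Lemma fourier_invK : cancel fourier_inv fourier.
Proof.
move=> f; apply/ffunP => i; rewrite ffunE.
under eq_bigr => j _.
  rewrite ffunE scalerA mulrC -scalerA cube_dotC; under eq_bigr do rewrite cube_dotC.
  over.
rewrite -scaler_sumr cube_inversion scalerA mulVf ?scale1r // expf_neq0 //.
by rewrite pnatr_eq0.
Qed.

End Fourier.

Section MagicRepresentation.
Variables (R : realType) (N : nat) (A : cstarAlgType R) (u : 'M[A]_N).

(* Phi is the coaction C^*(Z_2^N) -> A \otimes C^*(Z_2^N) attached to u. *)
Definition hypercube_coaction
    (Phi : {lrmorphism galg (cube N) R[i] -> galg (cube N) A}) : Prop :=
  (forall f, Phi (galg_star Num.conj f) = galg_star star (Phi f)) /\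
  (forall i, Phi (gtens 1 (cube_gen i)) =
             \sum_j gtens (u i j) (cube_gen j)).

Definition Psi (Phi : galg (cube N) R[i] -> galg (cube N) A)
    (f : {ffun cube N -> R[i]}) : {ffun cube N -> A} :=
  fourier (Phi (fourier_inv f)).

Definition delta (i : cube N) : {ffun cube N -> R[i]} :=
  [ffun j => (j == i)%:R].

(* The coefficient of \delta_k in Psi (\delta_i). *)
Definition magic_rep (Phi : galg (cube N) R[i] -> galg (cube N) A)
  (i k : cube N) : A := Psi Phi (delta i) k.

Definition magic_character (Phi : galg (cube N) R[i] -> galg (cube N) A) : A :=
  \sum_i magic_rep Phi i i.

(* perm_on D s says that s is the identity outside of D; the big product ranges
   over D in increasing order. *)
Definition chi_part (r : nat) : A :=
  \sum_(D : {set 'I_N} | #|D| == r) \sum_(s : 'S_N | perm_on D s)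
    \prod_(a < N | a \in D) u a (s a).

End MagicRepresentation.

(* Main.v *)
Require Import Defs.
From HB Require Import structures.
From mathcomp Require Import all_boot all_order all_algebra all_fingroup.
From mathcomp Require Import complex reals.

(** The matrix [magic_rep Phi] is obtained from that of [Phi], in the basis of
    group elements, by the Fourier change of basis. Its character is therefore
    the trace of [Phi]: the sum over [g] of the coefficient of [g] in [Phi g]
    ([magic_characterE]).

    Group elements are the products [g_D] of the generators indexed by a subset
    [D]. As [Phi] is multiplicative, [Phi g_D] is the ordered product over [a]
    in [D] of [\sum_j u a j \otimes g_j]. Expanding it gives a sum over the maps
    [f] that are the identity outside of [D], the term of [f] being
    [\prod_(a in D) u a (f a)] placed at the group element
    [\sum_(a in D) e_(f a)] ([coaction_cube_of_set]). This element is [g_D]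
    exactly when [f] is a permutation ([sum_cube_gen_eq]): adding the generators
    outside of [D] to both sides, the condition says that all the fibres of [f]
    have odd cardinality, so [f] is onto, hence bijective. The coefficient of
    [g_D] in [Phi g_D] is thus the sum over the permutations supported in [D]
    ([coaction_diag_coef]), and grouping the subsets by cardinality gives the
    formula. *)

Set Implicit Arguments.
Unset Strict Implicit.
Unset Printing Implicit Defensive.

Import Order.TTheory GRing.Theory Num.Theory.

Local Open Scope ring_scope.
Local Open Scope complex_scope.

Section GroupElements.
Variables (G : finZmodType) (A : nzRingType).

Lemma gtensM (a b : A) (x y : G) :
  gtens a x * gtens b y = gtens (a * b) (x + y).
Proof.
apply/ffunP => g; rewrite !ffunE (bigD1 x) //= !ffunE eqxx big1 => [|z /negPf zx].
  by rewrite addr0 subr_eq [y + x]addrC; case: ifP; rewrite ?mulr0.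
by rewrite !ffunE zx mul0r.
Qed.

Lemma gtens_prod (I : Type) (r : seq I) (P : pred I) (a : I -> A) (x : I -> G) :
  \prod_(i <- r | P i) gtens (a i) (x i) =
  gtens (\prod_(i <- r | P i) a i) (\sum_(i <- r | P i) x i).
Proof.
by apply: (big_rec3 (fun s b p => p = gtens b s)) => // i s b p _ ->; rewrite gtensM.
Qed.

Lemma galg_sumE (I : Type) (r : seq I) (P : pred I) (F : I -> galg G A) (g : G) :
  (\sum_(i <- r | P i) F i) g = \sum_(i <- r | P i) F i g.
Proof.
by apply: (big_morph (fun f : galg G A => f g)) => [f h|]; rewrite ffunE.
Qed.

End GroupElements.

Lemma galg_scaleE (K : nzRingType) (G : finZmodType) (A : lalgType K) (c : K)
  (f : galg G A) (g : G) : (c *: f) g = c *: f g.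
Proof. by rewrite ffunE. Qed.

Section Character.
Variables (R : realType) (N : nat) (A : cstarAlgType R).
Variable Phi : {lrmorphism galg (cube N) R[i] -> galg (cube N) A}.

Lemma fourier_inv_delta (i : cube N) :
  fourier_inv (delta R i) =
  (2 ^+ N)^-1 *: \sum_g (-1) ^+ cube_dot g i *: (gtens 1 g : galg (cube N) R[i]).
Proof.
apply/ffunP => h; rewrite ffunE galg_scaleE galg_sumE.
rewrite (bigD1 i) //= big1 => [|j /negPf ji]; last by rewrite ffunE ji scaler0.
rewrite [in RHS](bigD1 h) //= big1 => [|j /negPf jh].
  by rewrite galg_scaleE !ffunE !eqxx.
by rewrite galg_scaleE ffunE eq_sym jh scaler0.
Qed.

Lemma magic_repE (i k : cube N) :
  magic_rep Phi i k =
  (2 ^+ N)^-1 *: \sum_g (-1) ^+ cube_dot g i *: fourier (Phi (gtens 1 g)) k.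
Proof.
have PhiE j : Phi (fourier_inv (delta R i)) j =
    (2 ^+ N)^-1 *: \sum_g (-1) ^+ cube_dot g i *: Phi (gtens 1 g) j.
  rewrite fourier_inv_delta linearZ linear_sum /= galg_scaleE galg_sumE.
  by congr (_ *: _); apply: eq_bigr => g _; rewrite linearZ galg_scaleE.
rewrite /magic_rep /Psi ffunE.
under eq_bigr do rewrite PhiE scalerA mulrC -scalerA scaler_sumr.
rewrite -scaler_sumr exchange_big; congr (_ *: _).
apply: eq_bigr => g _; rewrite ffunE scaler_sumr.
by apply: eq_bigr => j _; rewrite !scalerA mulrC.
Qed.

(** Invariance of the trace under the Fourier change of basis: summing the
    signs over the diagonal index [i] is a Fourier inversion, which keeps only
    the coefficient of [Phi g] at [g]. *)
Lemma magic_characterE : magic_character Phi = \sum_g Phi (gtens 1 g) g.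
Proof.
rewrite /magic_character; under eq_bigr do rewrite magic_repE.
rewrite -scaler_sumr exchange_big scaler_sumr; apply: eq_bigr => g _.
under eq_bigr do rewrite ffunE.
by rewrite cube_inversion scalerA mulVf ?scale1r // expf_neq0 // pnatr_eq0.
Qed.

End Character.

Section CubeSubsets.
Variable N : nat.
Implicit Type D : {set 'I_N}.

(** The group element [g_D], whose coordinates are the indicator of [D]. *)
Definition cube_of_set D : cube N := \sum_(a in D) cube_gen a.

Lemma cube_of_setE D k : cube_of_set D 0 k = (k \in D)%:R.
Proof.
rewrite summxE; case: (boolP (k \in D)) => [kD|/negPf kD]; last first.
  rewrite big1 // => a aD; rewrite mxE eqxx /=.
  by case: eqP aD kD => // -> ->.
rewrite (bigD1 k) //= mxE !eqxx big1 ?addr0 // => a /andP[_ ak].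
by rewrite mxE eq_sym (negPf ak) andbF.
Qed.

Lemma cube_of_set_bij : bijective cube_of_set.
Proof.
exists (fun g : cube N => [set k | g 0 k == 1]) => [D|g].
  by apply/setP => k; rewrite inE cube_of_setE; case: (k \in D).
apply/rowP => k; rewrite cube_of_setE inE.
by case: (g 0 k) => [[|[|//]] ?]; apply/val_inj.
Qed.

(** The sum of all generators is the all-ones vector. If [f] misses [k], the sum
    of the [e_(f a)] vanishes at [k]; so equality makes [f] onto, hence
    injective since its source and target are the same finite set. *)
Lemma sum_cube_gen_inj (f : {ffun 'I_N -> 'I_N}) :
  (\sum_a cube_gen (f a) == \sum_a cube_gen a) = injectiveb f.
Proof.
apply/eqP/injectiveP => [sum_f|inj_f]; last first.
  by rewrite [RHS](reindex_inj inj_f).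
have f_onto k : k \in codom f.
  have ones_k : (\sum_a cube_gen a : cube N) 0 k = 1.
    have -> : \sum_a cube_gen a = cube_of_set [set: 'I_N].
      by apply: eq_bigl => a; rewrite inE.
    by rewrite cube_of_setE inE.
  apply/negPn/negP => k_codom; move: ones_k; rewrite -sum_f summxE big1 // => a _.
  rewrite mxE eqxx /=; case: eqP => // ka.
  by case/negP: k_codom; rewrite ka codom_f.
apply/injectiveP/card_uniqP; rewrite size_codom.
by apply: eq_card => k; rewrite f_onto.
Qed.

End CubeSubsets.

Section Coaction.
Variables (R : realType) (N : nat) (A : cstarAlgType R) (u : 'M[A]_N).
Variable Phi : {lrmorphism galg (cube N) R[i] -> galg (cube N) A}.
Hypothesis Phi_gen : forall i,
  Phi (gtens 1 (cube_gen i)) = \sum_j gtens (u i j) (cube_gen j).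
Implicit Type D : {set 'I_N}.

(** Expansion of the product of the images of the generators. A factor [1] is
    inserted at each [a] outside of [D], as a sum over the single index [a], so
    that distributivity yields maps on the whole index set which are the
    identity outside of [D], ready to be compared with permutations. *)
Lemma coaction_cube_of_set D :
  Phi (gtens 1 (cube_of_set D)) =
  \sum_(f in family (fun a j => (a \in D) || (j == a)))
    gtens (\prod_(a in D) u a (f a)) (\sum_(a in D) cube_gen (f a)).
Proof.
have -> : gtens 1 (cube_of_set D) =
    \prod_(a in D) (gtens 1 (cube_gen a) : galg (cube N) R[i]).
  by rewrite gtens_prod big1_eq.
rewrite rmorph_prod big_mkcond.
pose F a j : galg (cube N) A := if a \in D then gtens (u a j) (cube_gen j) else 1.
transitivity (\prod_a \sum_(j | (a \in D) || (j == a)) F a j).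
  apply: eq_bigr => a _; rewrite /F; case: ifP => _ /=; first exact: Phi_gen.
  by rewrite big_pred1_eq.
rewrite bigA_distr_big_dep; apply: eq_bigr => f _.
by rewrite -big_mkcond gtens_prod.
Qed.

(** Since [f] is the identity outside of [D], adding the generators outside of
    [D] turns this into the condition of [sum_cube_gen_inj]. *)
Lemma sum_cube_gen_eq D (f : {ffun 'I_N -> 'I_N}) :
  f \in family (fun a j => (a \in D) || (j == a)) ->
  (cube_of_set D == \sum_(a in D) cube_gen (f a)) = injectiveb f.
Proof.
move=> /familyP fD; rewrite -sum_cube_gen_inj eq_sym.
rewrite [X in _ = (X == _)](bigID (mem D)) [X in _ = (_ == X)](bigID (mem D)) /=.
rewrite [X in _ = (_ + X == _)](eq_bigr (@cube_gen N)) => [|a aD].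
  by rewrite (inj_eq (@addIr _ _)).
by have /orP[|/eqP->//] : (a \in D) || (f a == a) := fD a; rewrite (negPf aD).
Qed.

Lemma coaction_diag_coef D :
  Phi (gtens 1 (cube_of_set D)) (cube_of_set D) =
  \sum_(s : 'S_N | perm_on D s) \prod_(a in D) u a (s a).
Proof.
rewrite coaction_cube_of_set galg_sumE.
under eq_bigr => f fD do rewrite ffunE (sum_cube_gen_eq fD).
rewrite -big_mkcondr (reindex (@pval _)) /=; last first.
  (* Injective maps are the permutations; the default value of the inverse is
     never taken on them. *)
  pose in_Sn := insubd (1%g : 'S_N).
  by exists in_Sn => /= f /andP[_ Uf]; first apply: val_inj; apply: insubdK.
apply: eq_big => [s|s _]; last by apply: eq_bigr => a _; rewrite pvalE.
rewrite (valP s) andbT; apply/familyP/subsetP => sD a.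
  rewrite inE => sa; have : (a \in D) || (pval s a == a) := sD a.
  by rewrite pvalE (negPf sa) orbF.
rewrite -[_ \in _]/((a \in D) || (pval s a == a)) pvalE.
by have := sD a; rewrite inE; case: (s a == a); rewrite ?orbT // => ->.
Qed.

End Coaction.

Theorem theorem3p5 (R : realType) (N : nat) (hN : (1 <= N)%N)
  (A : cstarAlgType R) (u : 'M[A]_N) (hu : is_onbar u)
  (Phi : {lrmorphism galg (cube N) R[i] -> galg (cube N) A})
  (hPhi : hypercube_coaction u Phi) :
  magic_character Phi = \sum_(0 <= r < N.+1) chi_part u r.
Proof.
have [_ Phi_gen] := hPhi.
rewrite magic_characterE (reindex (@cube_of_set N)) /=; last first.
  exact/onW_bij/cube_of_set_bij.
under eq_bigr do rewrite (coaction_diag_coef Phi_gen).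
have cardD (D : {set 'I_N}) : (#|D| < N.+1)%N.
  by rewrite ltnS -[leqRHS]card_ord max_card.
rewrite (partition_big (fun D => Ordinal (cardD D)) xpredT) //= big_mkord.
by apply: eq_bigr => r _; apply: eq_bigl => D.
Qed.
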